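(* Let $r,n\ge 1$ and $m\in\{1,\dots,r\}$ be integers, let $\Sigma\in\mathbb{R}^{r\times r}$ be symmetric positive definite, and let $\Sigma^{1/2}$ denote its unique symmetric positive definite square root. Let $S\sim\mathcal{W}_r(n,\Sigma)$ and $W\sim\mathcal{W}_r(n,I_r)$. Then $$\mathrm{E}[S^{(m)}]=(\Sigma^{1/2})^{(m)}\,\mathrm{E}[W^{(m)}]\,(\Sigma^{1/2})^{(m)},$$ $$\mathrm{E}[S^{(m)}\otimes S^{(m)}]=\big[(\Sigma^{1/2})^{(m)}\otimes(\Sigma^{1/2})^{(m)}\big]\,\big(\mathrm{E}[W^{(m)}\otimes W^{(m)}]\big)\,\big[(\Sigma^{1/2})^{(m)}\otimes(\Sigma^{1/2})^{(m)}\big],$$ $$\mathrm{Cov}[S^{(m)}]=\mathrm{E}[S^{(m)}\otimes S^{(m)}]-\big(\mathrm{E}[S^{(m)}]\otimes\mathrm{E}[S^{(m)}]\big)=\big[(\Sigma^{1/2})^{(m)}\otimes(\Sigma^{1/2})^{(m)}\big]\,\big(\mathrm{Cov}[W^{(m)}]\big)\,\big[(\Sigma^{1/2})^{(m)}\otimes(\Sigma^{1/2})^{(m)}\big].$$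
   Context: The Wishart distribution $\mathcal{W}_r(n,\Sigma)$ is the law of $XX^T$, where $X\in\mathbb{R}^{r\times n}$ has independent columns each distributed as $\mathcal{N}_r(0,\Sigma)$; $I_r$ is the identity matrix. For $A\in\mathbb{R}^{r\times r}$ and $m\in\{1,\dots,r\}$, the $m$th compound $A^{(m)}$ is the $\binom{r}{m}\times\binom{r}{m}$ matrix $(\det(A_{I\times J}))_{I,J}$ indexed by the $m$-element subsets $I,J$ of $\{1,\dots,r\}$, where $A_{I\times J}$ is the submatrix with row indices in $I$ and column indices in $J$ (each index set listed in a fixed order, e.g. increasing). $\otimes$ is the Kronecker product. For a random square matrix $M$, $\mathrm{E}[M]$ is taken entrywise and $\mathrm{Cov}[M]$ denotes the array of covariances of pairs of entries arranged as $\mathrm{Cov}[M]=\mathrm{E}[M\otimes M]-\mathrm{E}[M]\otimes\mathrm{E}[M]$. *)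

(* Defs.v *)
From HB Require Import structures.
From mathcomp Require Import all_boot all_order all_algebra.
From mathcomp Require Import mxtens.
From mathcomp Require Import all_classical all_reals all_analysis.
Import Order.TTheory GRing.Theory Num.Theory.
Import numFieldNormedType.Exports.

Set Implicit Arguments.
Unset Strict Implicit.
Unset Printing Implicit Defensive.

Local Open Scope classical_set_scope.
Local Open Scope ring_scope.

Definition ksubset (r m : nat) := {I : {set 'I_r} | #|I| == m}.

Lemma card_ksubset r m : #|{: ksubset r m}| = 'C(r, m).
Proof.
rewrite card_sig -[in RHS](card_ord r) -card_draws.
by apply: eq_card => I; rewrite !inE.
Qed.

Definition nth_ksubset (r m : nat) (i : 'I_'C(r, m)) : ksubset r m :=
  enum_val (cast_ord (esym (card_ksubset r m)) i).

(* [enum_val] follows the order of ['I_r], so [ksubset_elt I] lists the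
   elements of [I] in increasing order. *)
Definition ksubset_elt (r m : nat) (I : ksubset r m) (k : 'I_m) : 'I_r :=
  enum_val (cast_ord (esym (eqP (valP I))) k).

Definition compound (R : comPzRingType) (r m : nat) (A : 'M[R]_r) :
    'M[R]_('C(r, m)) :=
  \matrix_(i, j) \det (mxsub (ksubset_elt (nth_ksubset i))
                             (ksubset_elt (nth_ksubset j)) A).

Definition posdef (R : numDomainType) (r : nat) (A : 'M[R]_r) : Prop :=
  A^T = A /\ forall v : 'cV[R]_r, v != 0 -> 0 < (v^T *m A *m v) 0 0.

Definition is_posdef_sqrt (R : numDomainType) (r : nat)
    (A Q : 'M[R]_r) : Prop :=
  posdef Q /\ Q *m Q = A.

(* Matrices carry the smallest sigma-algebra making all entries Borel
   measurable; this is the Borel sigma-algebra of R^(p x q). *)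

Definition mx_cylinder (R : realType) (p q : nat) : set (set 'M[R]_(p, q)) :=
  [set A | exists (i : 'I_p) (j : 'I_q), exists2 B : set R,
     measurable B & A = [set M : 'M[R]_(p, q) | B (M i j)]].

Definition mx_measure_display : measure_display.
Proof. exact: default_measure_display. Qed.

Section matrix_measurable.
Variables (R : realType) (p q : nat).

HB.instance Definition _ := @isMeasurable.Build mx_measure_display
  'M[R]_(p, q) <<s @mx_cylinder R p q >>
  (@sigma_algebra0 _ setT (@mx_cylinder R p q))
  (@sigma_algebraC _ (@mx_cylinder R p q))
  (@sigma_algebra_bigcup _ setT (@mx_cylinder R p q)).

End matrix_measurable.

Definition independent_family (I : finType) d d' (T : measurableType d)
    (T' : measurableType d') (R : realType) (P : probability T R)
    (X : I -> T -> T') : Prop :=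
  forall (J : {set I}) (B : I -> set T'), (forall i, measurable (B i)) ->
    P (\bigcap_(i in [set i | i \in J]) (X i @^-1` B i)) =
    (\prod_(i in J) P (X i @^-1` B i))%E.

(* The law N(mu, s^2); [normal_prob mu 0] is not the point mass at [mu], so the
   degenerate case is treated apart. *)
Definition normal_law (R : realType) (mu s : R) : set R -> \bar R :=
  if s == 0 then \d_mu else normal_prob mu s.

(* N_r(mu, Sigma), defined through its one-dimensional projections: x has this
   law when, for every vector a, a^T x has the law
   N(a^T mu, a^T Sigma a). *)
Definition mvnormal (R : realType) (r : nat) (mu : 'cV[R]_r) (Sigma : 'M[R]_r)
    (nu : set 'cV[R]_r -> \bar R) : Prop :=
  forall (a : 'cV[R]_r) (B : set R), measurable B ->
    pushforward nu (fun x : 'cV[R]_r => (a^T *m x) 0 0 : R) B =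
    normal_law ((a^T *m mu) 0 0) (Num.sqrt ((a^T *m Sigma *m a) 0 0)) B.

Definition gaussian_columns d (T : measurableType d) (R : realType)
    (P : probability T R) (r n : nat) (Sigma : 'M[R]_r)
    (X : {RV P >-> 'M[R]_(r, n)}) : Prop :=
  independent_family P (fun (j : 'I_n) (w : T) => col j (X w)) /\
  forall j : 'I_n, mvnormal 0 Sigma (pushforward P (fun w => col j (X w))).

(* A predicate on laws: the random matrix X may live on any probability
   space. *)
Definition wishart (R : realType) (r n : nat) (Sigma : 'M[R]_r)
    (nu : set 'M[R]_r -> \bar R) : Prop :=
  exists (d : measure_display) (T : measurableType d) (P : probability T R)
         (X : {RV P >-> 'M[R]_(r, n)}),
    gaussian_columns Sigma X /\
    forall A : set 'M[R]_r, measurable A ->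
      nu A = pushforward P (fun w => X w *m (X w)^T) A.

Definition mxExp d (T : measurableType d) (R : realType) (P : probability T R)
    (p q : nat) (M : T -> 'M[R]_(p, q)) : 'M[R]_(p, q) :=
  \matrix_(i, j) fine 'E_P[fun w => M w i j].

(* Covariances of pairs of entries, placed as in the Kronecker product: the
   ((i1, i2), (j1, j2)) entry of [M *t M] is [M i1 j1 * M i2 j2]. *)
Definition mxCov d (T : measurableType d) (R : realType) (P : probability T R)
    (p q : nat) (M : T -> 'M[R]_(p, q)) : 'M[R]_(p * p, q * q) :=
  \matrix_(i, j) fine (covariance P
    (fun w => M w (mxtens_unindex i).1 (mxtens_unindex j).1)
    (fun w => M w (mxtens_unindex i).2 (mxtens_unindex j).2)).

(* Main.v *)
From HB Require Import structures.
Require Import Defs.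
From mathcomp Require Import all_boot all_order all_algebra.
From mathcomp Require Import fingroup perm.
From mathcomp Require Import ring lra.
From mathcomp Require Import mxtens.
From mathcomp Require Import all_classical all_reals all_analysis.
From mathcomp Require Import measurable_realfun.
Local Open Scope ring_scope.

(** Write [S] as the Gram matrix [X *m X^T] with independent [N(0, Sigma)]
    columns and [W] as [Y *m Y^T] with independent [N(0, 1)] columns.  The
    columns of [Q *m Y] are again independent and [N(0, Q *m Q^T)], that is
    [N(0, Sigma)], so [S] should behave like
    [(Q *m Y) *m (Q *m Y)^T = Q *m W *m Q].  The Cauchy-Binet formula makes
    compounds multiplicative ([compound_mul]), hence the compound of
    [Q *m W *m Q] is that of [W] multiplied by that of [Q] on both sides.
    Linearity of the expectation and the mixed product rule for Kronecker
    products then give the formulas for the two expectations, and the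
    covariance is a difference of these.

    The probabilistic point is the passage from [X] to [Q *m Y].  Gaussian
    vectors are known only through their one-dimensional projections, and
    recovering the law of a vector from those is the theorem of Cramer and
    Wold.  It can be avoided, because the entries of a compound are polynomials
    in the entries of the matrix: it suffices that [X] and [Q *m Y] give the
    same expectation to every polynomial ([gaussian_polyfun_mean]).  Three facts
    yield this.

    - All polynomials are integrable, because the normal density beats every
      power ([normal_law_has_moments]).

    - Choose one linear form for each column.  By independence of the columns,
      the joint law of the values of these forms is fixed on rectangles by the
      one-dimensional projections, hence everywhere ([rectangles_law]).
      Therefore [X] and [Q *m Y] agree on products of powers of linear forms,
      one form per column.

    - Such products span all polynomials, by polarization: replacing a form
      [u] by [u + t v] in [u ^ k.+1] and taking the coefficient of [t] produces
      [u ^ k * v] up to a factor, so arbitrary extra factors can be split off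
      one at a time ([same_mean_mono_entries], [polyfun_same_mean]). *)

Import Order.TTheory GRing.Theory Num.Theory.

Set Implicit Arguments.
Unset Strict Implicit.
Unset Printing Implicit Defensive.

(** * The Cauchy-Binet formula and compounds of products *)

Section CauchyBinet.
Variable R : comPzRingType.

Lemma ksubset_elt_inj r m (K : ksubset r m) : injective (ksubset_elt K).
Proof. by move=> i j /enum_val_inj /cast_ord_inj. Qed.

Lemma ksubset_elt_image r m (K : ksubset r m) :
  ksubset_elt K @: [set: 'I_m] = val K.
Proof.
apply/eqP; rewrite eqEcard; apply/andP; split.
  by apply/fintype.subsetP => x /imsetP[i _ ->]; exact: enum_valP.
rewrite card_imset ?cardsT ?card_ord; last exact: ksubset_elt_inj.
by rewrite (eqP (valP K)).
Qed.

(** Injections of [m] points into [r] are encoded as an image together with a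
    permutation of its elements; this is what regroups the sum over maps in
    the Cauchy-Binet formula into minors. *)
Definition arrangement r m (Kt : ksubset r m * 'S_m) : {ffun 'I_m -> 'I_r} :=
  [ffun i => ksubset_elt Kt.1 (Kt.2 i)].

Lemma arrangement_inj r m : injective (@arrangement r m).
Proof.
move=> [K s] [L t] /ffunP KsLt.
have image_arr (J : ksubset r m) (u : 'S_m) :
    [set arrangement (J, u) i | i in [set: 'I_m]] = val J.
  rewrite -ksubset_elt_image; apply/setP => x; apply/imsetP/imsetP => -[i _ ->].
    by exists (u i); rewrite ?inE ?ffunE.
  by exists ((u^-1)%g i); rewrite ?inE ?ffunE //= permKV.
(* The image of the arrangement determines [K]. *)
have KL : K = L.
  apply: val_inj; rewrite -(image_arr K s) -(image_arr L t).
  by apply: eq_imset => i; exact: KsLt.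
subst L; congr (_, _); apply/permP => i.
by apply: (@ksubset_elt_inj _ _ K); have := KsLt i; rewrite !ffunE.
Qed.

(** The arrangements are pairwise distinct injections, and their number
    [C(r, m) * m`!] is the falling factorial that counts all injections. *)
Lemma arrangement_codom r m :
  [set f : {ffun 'I_m -> 'I_r} | injectiveb f] =
  [set arrangement Kt | Kt in [set: ksubset r m * 'S_m]].
Proof.
apply/esym/eqP; rewrite eqEcard; apply/andP; split.
  apply/fintype.subsetP => f /imsetP[[K s] _ ->]; rewrite inE.
  apply/injectiveP => i j; rewrite !ffunE => /ksubset_elt_inj.
  exact: perm_inj.
rewrite card_imset; last exact: arrangement_inj.
rewrite cardsT card_prod card_ksubset card_Sn bin_ffact.
by rewrite card_inj_ffuns !card_ord.
Qed.

(** Multilinearity in the rows turns the determinant into a sum over all maps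
    [f] from rows to inner indices.  A map that is not injective contributes a
    determinant with two equal rows; the injective ones with a given image
    [K] differ by a permutation, whose sign rebuilds the minor of [A]. *)
Lemma cauchy_binet r m (A : 'M[R]_(m, r)) (B : 'M[R]_(r, m)) :
  \det (A *m B) = \sum_(K : ksubset r m)
    \det (colsub (ksubset_elt K) A) * \det (rowsub (ksubset_elt K) B).
Proof.
transitivity (\sum_(f : {ffun 'I_m -> 'I_r})
    (\prod_i A i (f i)) * \det (rowsub f B)).
  transitivity (\sum_(f : {ffun 'I_m -> 'I_r}) \sum_(s : 'S_m)
      (-1) ^+ s * \prod_i (A i (f i) * B (f i) (s i))).
    rewrite exchange_big; apply: eq_bigr => /= s _; rewrite -big_distrr /=.
    congr (_ * _); rewrite -(bigA_distr_bigA (fun i j => A i j * B j (s i))) /=.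
    by apply: eq_bigr => i _; rewrite mxE.
  apply: eq_bigr => f _; rewrite big_distrr /=; apply: eq_bigr => s _.
  rewrite big_split /= mulrCA; congr (_ * (_ * _)).
  by apply: eq_bigr => i _; rewrite mxE.
rewrite (bigID (mem [set f : {ffun 'I_m -> 'I_r} | injectiveb f])) /= addrC.
rewrite big1 ?add0r; last first.
  move=> f; rewrite inE => /injectivePn[i1 [i2 Di12 Ef12]].
  by rewrite (determinant_alternate Di12) ?mulr0 // => j; rewrite !mxE Ef12.
rewrite arrangement_codom big_imset /=; last by move=> ? ? _ _ /arrangement_inj.
rewrite (eq_bigl xpredT); last by move=> Kt; rewrite inE.
rewrite -(pair_bigA _ (fun K s => (\prod_i A i (arrangement (K, s) i)) *
  \det (rowsub (arrangement (K, s)) B))) /=.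
apply: eq_bigr => K _; rewrite big_distrl /=; apply: eq_bigr => s _.
have -> : rowsub (arrangement (K, s)) B = row_perm s (rowsub (ksubset_elt K) B).
  by apply/matrixP => i j; rewrite !mxE ffunE.
rewrite row_permE det_mulmx det_perm mulrCA mulrA; congr (_ * _ * _).
by apply: eq_bigr => i _; rewrite !mxE ffunE.
Qed.

Lemma nth_ksubset_bij r m : bijective (@nth_ksubset r m).
Proof.
exists (fun K => cast_ord (card_ksubset r m) (enum_rank K)) => [i|K].
  by rewrite /nth_ksubset enum_valK cast_ordKV.
by rewrite /nth_ksubset cast_ordK enum_rankK.
Qed.

Lemma compound_mul r m (A B : 'M[R]_r) :
  compound m (A *m B) = compound m A *m compound m B.
Proof.
apply/matrixP => i j; rewrite !mxE mxsub_mul cauchy_binet.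
rewrite (reindex (@nth_ksubset r m)); last exact/onW_bij/nth_ksubset_bij.
apply: eq_bigr => k _; rewrite [compound m A _ _]mxE [compound m B _ _]mxE.
by congr (_ * _); congr determinant; apply/matrixP => a b; rewrite !mxE.
Qed.

End CauchyBinet.

(** * Measurability, polynomials and finite moments of random matrices *)

Section MatrixMeasurability.
Local Open Scope classical_set_scope.
Variables (R : realType) (p q : nat).

Lemma measurable_mx_entry (i : 'I_p) (j : 'I_q) :
  measurable_fun [set: 'M[R]_(p, q)] (fun M : 'M[R]_(p, q) => M i j : R).
Proof.
move=> _ B mB; rewrite setTI; apply: sub_sigma_algebra.
by exists i, j, B.
Qed.

(** Cylinders generate, so measurability may be tested on entries. *)
Lemma measurable_fun_mx d (T : measurableType d) (f : T -> 'M[R]_(p, q)) :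
  (forall i j, measurable_fun [set: T] (fun w => f w i j : R)) ->
  measurable_fun [set: T] f.
Proof.
move=> mf; apply: (@measurability _ _ _ _ _ _ (@mx_cylinder R p q)) => //.
move=> _ [_ [i [j [B mB ->]]] <-].
by rewrite setTI -[X in measurable X]setTI; exact: mf.
Qed.

End MatrixMeasurability.

Section Polynomial.
Variables (R : realType).

(** Only closure properties of polynomial functions of a matrix are used, never
    their coefficients, so they are generated as an algebra of functions. *)
Inductive polyfun p q : ('M[R]_(p, q) -> R) -> Prop :=
| polyfun_cst c : polyfun (fun=> c)
| polyfun_entry i j : polyfun (fun M => M i j)
| polyfunD f g : polyfun f -> polyfun g -> polyfun (fun M => f M + g M)
| polyfunM f g : polyfun f -> polyfun g -> polyfun (fun M => f M * g M).

Lemma polyfun_sum p q (I : Type) (s : seq I) (F : I -> 'M[R]_(p, q) -> R) :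
  (forall i, polyfun (F i)) -> polyfun (fun M => \sum_(i <- s) F i M).
Proof.
move=> pF; elim: s => [|i s IH].
  by under eq_fun do rewrite big_nil; exact: polyfun_cst.
by under eq_fun do rewrite big_cons; exact: polyfunD.
Qed.

Lemma polyfun_prod p q (I : Type) (s : seq I) (P : pred I)
    (F : I -> 'M[R]_(p, q) -> R) :
  (forall i, polyfun (F i)) -> polyfun (fun M => \prod_(i <- s | P i) F i M).
Proof.
move=> pF; elim: s => [|i s IH].
  by under eq_fun do rewrite big_nil; exact: polyfun_cst.
under eq_fun do rewrite big_cons.
by case: (P i) => //; exact: polyfunM.
Qed.

Lemma polyfunX p q (f : 'M[R]_(p, q) -> R) k :
  polyfun f -> polyfun (fun M => f M ^+ k).
Proof.
move=> pf; elim: k => [|k IH].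
  by under eq_fun do rewrite expr0; exact: polyfun_cst.
by under eq_fun do rewrite exprS; exact: polyfunM.
Qed.

Lemma polyfun_comp p q p' q' (f : 'M[R]_(p', q') -> R)
    (G : 'M[R]_(p, q) -> 'M[R]_(p', q')) :
  polyfun f -> (forall i j, polyfun (fun M => G M i j)) ->
  polyfun (fun M => f (G M)).
Proof.
move=> pf pG; elim: pf => {f} [c|i j|f g _ pf _ pg|f g _ pf _ pg].
- exact: polyfun_cst.
- exact: pG.
- exact: polyfunD.
- exact: polyfunM.
Qed.

Lemma polyfun_det p q m (e : 'I_m -> 'I_p) (f : 'I_m -> 'I_q) :
  polyfun (fun M : 'M[R]_(p, q) => \det (mxsub e f M)).
Proof.
apply: polyfun_sum => s; apply: polyfunM; first exact: polyfun_cst.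
apply: polyfun_prod => i; under eq_fun do rewrite mxE.
exact: polyfun_entry.
Qed.

Lemma polyfun_measurable p q (f : 'M[R]_(p, q) -> R) :
  polyfun f -> measurable_fun [set: 'M[R]_(p, q)]%classic f.
Proof.
elim=> {f} [c|i j|f g _ mf _ mg|f g _ mf _ mg].
- exact: measurable_cst.
- exact: measurable_mx_entry.
- exact: measurable_funD.
- exact: measurable_funM.
Qed.

End Polynomial.

Section Moments.
Local Open Scope classical_set_scope.
Context d (T : measurableType d) (R : realType) (P : probability T R).
Implicit Types Y Z : T -> R.

(** Finiteness of all moments, rather than integrability alone, is the condition
    that is stable under products. *)
Definition has_moments Z := forall k, (fun w => Z w ^+ k) \in Lfun P 1.

Lemma Lfun1_measurable Z : Z \in Lfun P 1 -> measurable_fun [set: T] Z.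
Proof. by move=> /Lfun1_integrable/integrableP[/measurable_EFinP]. Qed.

Lemma has_moments_Lfun1 Z : has_moments Z -> Z \in Lfun P 1.
Proof. by move=> /(_ 1%N); under eq_fun do rewrite expr1. Qed.

Lemma has_moments_measurable Z : has_moments Z -> measurable_fun [set: T] Z.
Proof. by move=> /has_moments_Lfun1/Lfun1_measurable. Qed.

Lemma has_moments_cst c : has_moments (fun=> c).
Proof. by move=> k; exact: (Lfun_cst P (c ^+ k)). Qed.

(** From [2 |a b| <= a ^+ 2 + b ^+ 2] with [a = Y ^+ k] and [b = Z ^+ l]. *)
Lemma has_moments_mulX Y Z k l : has_moments Y -> has_moments Z ->
  (fun w => Y w ^+ k * Z w ^+ l) \in Lfun P 1.
Proof.
move=> mY mZ.
have sqr2 : (fun w => Y w ^+ (k * 2) + Z w ^+ (l * 2)) \in Lfun P 1.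
  exact: (rpredD (mY (k * 2)%N) (mZ (l * 2)%N)).
apply/Lfun1_integrable; move/Lfun1_integrable: sqr2.
apply: le_integrable => //.
  apply/measurable_EFinP; apply: measurable_funM;
    by apply: measurable_funX; exact: has_moments_measurable.
move=> w _ /=; rewrite lee_fin !exprM.
rewrite [leRHS]ger0_norm ?addr_ge0 ?sqr_ge0 //.
set a := _ ^+ k; set b := _ ^+ l.
rewrite normrM -[in leRHS](real_normK (num_real a)).
rewrite -[in leRHS](real_normK (num_real b)).
have := normr_ge0 a; have := normr_ge0 b; have := sqr_ge0 (`|a| - `|b|).
nra.
Qed.

Lemma has_momentsM Y Z : has_moments Y -> has_moments Z ->
  has_moments (fun w => Y w * Z w).
Proof.
move=> mY mZ k; under eq_fun do rewrite exprMn.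
exact: has_moments_mulX.
Qed.

Lemma has_momentsD Y Z : has_moments Y -> has_moments Z ->
  has_moments (fun w => Y w + Z w).
Proof.
move=> mY mZ k.
rewrite (_ : (fun w => _) = \sum_(i < k.+1)
   ((fun w => Y w ^+ (k - i) * Z w ^+ i) *+ 'C(k, i))); last first.
  apply/funext => w; rewrite exprDn fct_sumE; apply: eq_bigr => i _.
  by elim: ('C(k, i)) => [//|c IH]; rewrite !mulrS IH.
by apply: rpred_sum => i _; apply: rpredMn; exact: has_moments_mulX.
Qed.

Lemma polyfun_has_moments p q (X : T -> 'M[R]_(p, q)) f :
  (forall i j, has_moments (fun w => X w i j)) ->
  polyfun f -> has_moments (fun w => f (X w)).
Proof.
move=> mX; elim=> {f} [c|i j|f g _ mf _ mg|f g _ mf _ mg].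
- exact: has_moments_cst.
- exact: mX.
- exact: has_momentsD.
- exact: has_momentsM.
Qed.

End Moments.

(** * Random elements with the same law *)

Section SameLaw.
Local Open Scope classical_set_scope.
Local Open Scope ereal_scope.
Context d (T : measurableType d) d' (T' : measurableType d')
  d0 (E : measurableType d0) (R : realType).
Variables (P : {measure set T -> \bar R}) (P' : {measure set T' -> \bar R}).
Variables (U : T -> E) (U' : T' -> E).
Hypotheses (mU : measurable_fun [set: T] U) (mU' : measurable_fun [set: T'] U').
Hypothesis sameUU' : forall A : set E, measurable A ->
  P (U @^-1` A) = P' (U' @^-1` A).

Lemma same_law_ge0_integral (f : E -> \bar R) :
  measurable_fun [set: E] f -> (forall x, 0 <= f x) ->
  \int[P]_w f (U w) = \int[P']_w f (U' w).
Proof.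
move=> mf f0.
have pushP := @ge0_integral_pushforward _ _ _ _ R U mU P setT f
  measurableT mf (fun x _ => f0 x).
have pushP' := @ge0_integral_pushforward _ _ _ _ R U' mU' P' setT f
  measurableT mf (fun x _ => f0 x).
rewrite !preimage_setT in pushP pushP'; rewrite -pushP -pushP'.
by apply: eq_measure_integral => A mA _; exact: sameUU'.
Qed.

Lemma same_law_integral (f : E -> \bar R) :
  measurable_fun [set: E] f ->
  \int[P]_w f (U w) = \int[P']_w f (U' w).
Proof.
move=> mf; rewrite integralE [in RHS]integralE.
have := @same_law_ge0_integral _ (measurable_funepos mf) (funepos_ge0 f).
have := @same_law_ge0_integral _ (measurable_funeneg mf) (funeneg_ge0 f).
rewrite -[fun w => f (U w)]/(f \o U) -[fun w => f (U' w)]/(f \o U').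
by rewrite (funepos_comp f U) (funepos_comp f U') (funeneg_comp f U)
  (funeneg_comp f U') /= => -> ->.
Qed.

End SameLaw.

Section SameLawProbability.
Local Open Scope classical_set_scope.
Context d (T : measurableType d) d' (T' : measurableType d')
  d0 (E : measurableType d0) (R : realType).
Variables (P : probability T R) (P' : probability T' R).
Variables (U : T -> E) (U' : T' -> E).
Hypotheses (mU : measurable_fun [set: T] U) (mU' : measurable_fun [set: T'] U').
Hypothesis sameUU' : forall A : set E, measurable A ->
  P (U @^-1` A) = P' (U' @^-1` A).
Variables (f : E -> R) (mf : measurable_fun [set: E] f).

Lemma same_law_expectation :
  ('E_P[fun w => f (U w)] = 'E_P'[fun w => f (U' w)])%E.
Proof.
rewrite unlock; apply: (same_law_integral mU mU' sameUU' (f := EFin \o f)).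
exact/measurable_EFinP.
Qed.

Lemma same_law_Lfun1 :
  (fun w => f (U' w)) \in Lfun P' 1 -> (fun w => f (U w)) \in Lfun P 1.
Proof.
move=> /Lfun1_integrable/integrableP[_ fin]; apply/Lfun1_integrable/integrableP.
split; first by apply/measurable_EFinP; exact: measurableT_comp mU.
apply: le_lt_trans fin; rewrite le_eqVlt; apply/orP; left; apply/eqP.
apply: (same_law_integral mU mU' sameUU' (f := fun x => `|(f x)%:E|%E)).
by apply: measurableT_comp => //; exact/measurable_EFinP.
Qed.

End SameLawProbability.

(** * Moments of the normal law *)

Section NormalMoments.
Local Open Scope classical_set_scope.
Variable R : realType.
Notation mu := (@lebesgue_measure R).

(** The Radon-Nikodym derivative of the normal law agrees almost everywhere with
    its density, as both have the same integral over every measurable set. *)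
Lemma ge0_integral_normal_prob (m s : R) (f : R -> \bar R) :
  measurable_fun [set: R] f -> (forall x, 0 <= f x)%E ->
  (\int[normal_prob m s]_x f x = \int[mu]_x (f x * (normal_pdf m s x)%:E))%E.
Proof.
move=> mf f0.
have dom := normal_prob_dominates m s.
rewrite -(Radon_Nikodym_SigmaFinite.change_of_variables dom) //.
have mD := measurable_int _ (Radon_Nikodym_SigmaFinite.f_integrable dom).
have mp : measurable_fun [set: R] (fun x => (normal_pdf m s x)%:E).
  by apply/measurable_EFinP; exact: measurable_normal_pdf.
apply: ae_eq_integral => //.
- exact: emeasurable_funM.
- exact: emeasurable_funM.
- apply: ae_eqe_mul2l; apply: integral_ae_eq => //.
    exact: Radon_Nikodym_SigmaFinite.f_integrable.
  by move=> A _ mA; rewrite -Radon_Nikodym_SigmaFinite.f_integral.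
Qed.

(** A single term of the exponential series at [c * x ^+ 2] bounds the power. *)
Lemma sqrXn_le_expR (x c : R) k : 0 < c ->
  x ^+ (k.+1 * 2) <= (k.+1)`!%:R / c ^+ k.+1 * expR (c * x ^+ 2).
Proof.
move=> c0.
have cx0 : 0 <= c * x ^+ 2 by rewrite mulr_ge0 ?sqr_ge0 // ltW.
have := expR_ge1Dxn k cx0.
set e := expR _ => le_e.
have fct0 : 0 < (k.+1)`!%:R :> R by rewrite ltr0n fact_gt0.
rewrite mulrAC ler_pdivlMr ?exprn_gt0 // -ler_pdivrMl //.
apply: le_trans le_e; rewrite exprMn -exprM (mulnC 2) mulrC.
by rewrite [_ * c ^+ _]mulrC lerDr.
Qed.

(** Half of the exponent can be given away to absorb a power of [x]; what is
    left is, up to a constant, the normal density of doubled variance, hence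
    integrable. *)
Lemma normal_pdf_scale (s x : R) : s != 0 ->
  expR (x ^+ 2 / (s ^+ 2 *+ 4)) * normal_pdf 0 s x =
  normal_peak s / normal_peak (Num.sqrt 2 * s) *
  normal_pdf 0 (Num.sqrt 2 * s) x.
Proof.
move=> s0.
have s20 : Num.sqrt 2 * s != 0 :> R by rewrite mulf_neq0 ?sqrtr_eq0 -?ltNge.
rewrite !normal_pdfE //.
rewrite [RHS]mulrA divfK; last by rewrite gt_eqF // normal_peak_gt0.
rewrite mulrCA; congr (_ * _); rewrite /normal_fun -expRD; congr expR.
rewrite exprMn sqr_sqrtr // subr0.
by field.
Qed.

Lemma normal_prob_moment (s : R) k : s != 0 ->
  (\int[normal_prob 0 s]_x (x ^+ (k.+1 * 2))%:E < +oo)%E.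
Proof.
move=> s0.
have mX : measurable_fun [set: R] (fun x : R => (x ^+ (k.+1 * 2))%:E).
  by apply/measurable_EFinP; exact: measurable_funX.
have ge0X x : (0 <= (x ^+ (k.+1 * 2))%:E :> \bar R)%E.
  by rewrite lee_fin exprM sqr_ge0.
rewrite ge0_integral_normal_prob //.
have s4 : 0 < (s ^+ 2 *+ 4)^-1.
  by rewrite invr_gt0 pmulrn_lgt0 // exprn_even_gt0.
(* The constants come from [sqrXn_le_expR], applied with [c] the inverse of
   [4 * s ^+ 2], and from [normal_pdf_scale]. *)
pose s' := Num.sqrt 2 * s.
pose C := (k.+1)`!%:R / (s ^+ 2 *+ 4)^-1 ^+ k.+1 *
  (normal_peak s / normal_peak s').
have /integrableP[_] :
    mu.-integrable setT (fun x => C%:E * (normal_pdf 0 s' x)%:E)%E.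
  by apply: integrableZl => //; exact: integrable_normal_pdf.
apply: le_lt_trans; apply: ge0_le_integral => //.
- by move=> x _; rewrite mule_ge0 // lee_fin normal_pdf_ge0.
- apply: emeasurable_funM => //; apply/measurable_EFinP.
  exact: measurable_normal_pdf.
- apply: measurableT_comp => //; apply/measurable_EFinP.
  apply: measurable_funM => //.
  exact: measurable_normal_pdf.
- move=> x _; apply: le_trans (lee_abs _).
  rewrite -!EFinM lee_fin /C /s' -[leRHS]mulrA -normal_pdf_scale // mulrA.
  apply: ler_wpM2r; first exact: normal_pdf_ge0.
  by rewrite [x ^+ 2 / _]mulrC; exact: sqrXn_le_expR.
Qed.

(** Even moments suffice, by [2 |a| <= 1 + a ^+ 2]. *)
Lemma normal_law_has_moments d (T : measurableType d) (P : probability T R)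
    (Z : T -> R) (s : R) :
  measurable_fun [set: T] Z ->
  (forall B, measurable B -> P (Z @^-1` B) = normal_law 0 s B) ->
  has_moments P Z.
Proof.
move=> mZ lawZ.
suff sqrZ k : (\int[P]_w (Z w ^+ (k.+1 * 2))%:E < +oo)%E.
  move=> [|k]; first by under eq_fun do rewrite expr0; exact: (Lfun_cst P 1).
  apply/Lfun1_integrable.
  apply: (@le_integrable _ _ _ P setT measurableT _
    (fun w => 1%:E + (Z w ^+ (k.+1 * 2))%:E)%E).
  - by apply/measurable_EFinP; exact: measurable_funX.
  - move=> w _; rewrite -EFinD lee_fin exprM.
    rewrite [leRHS]ger0_norm ?addr_ge0 ?sqr_ge0 //.
    set a := _ ^+ k.+1; rewrite -(real_normK (num_real a)).
    have := sqr_ge0 (`|a| - 1); have := normr_ge0 a; nra.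
  - apply: integrableD => //; first exact: finite_measure_integrable_cst.
    apply/integrableP; split.
      by apply/measurable_EFinP; exact: measurable_funX.
    under eq_integral do rewrite gee0_abs ?lee_fin ?exprM ?sqr_ge0 // -exprM.
    exact: sqrZ.
have mX : measurable_fun [set: R] (fun x : R => (x ^+ (k.+1 * 2))%:E).
  by apply/measurable_EFinP; exact: measurable_funX.
have [s0|s0] := eqVneq s 0.
  have same A : measurable A -> P (Z @^-1` A) = \d_(0 : R) (id @^-1` A).
    by move=> mA; have := lawZ A mA; rewrite /normal_law s0 eqxx.
  rewrite (same_law_integral mZ (@measurable_id _ _ _) same mX).
  by rewrite integral_dirac // diracT mul1e ltry.
have same A : measurable A -> P (Z @^-1` A) = normal_prob 0 s (id @^-1` A).
  by move=> mA; have := lawZ A mA; rewrite /normal_law (negbTE s0).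
rewrite (same_law_integral (P' := normal_prob 0 s) mZ (@measurable_id _ _ _)
  same mX).
exact: normal_prob_moment.
Qed.

End NormalMoments.

(** * Polarization *)

Section Mean.
Context d (T : measurableType d) (R : realType) (P : probability T R).
Implicit Types Y Z : T -> R.

(** Real-valued expectation, so that identities between polynomials in a real
    parameter can be compared coefficientwise. *)
Definition mean Z : R := fine 'E_P[Z].

Lemma meanD Y Z : Y \in Lfun P 1 -> Z \in Lfun P 1 ->
  mean (fun w => Y w + Z w) = mean Y + mean Z.
Proof.
move=> Y1 Z1; rewrite /mean -fineD ?expectation_fin_num //.
by rewrite -expectationD.
Qed.

Lemma meanZ c Z : Z \in Lfun P 1 -> mean (fun w => c * Z w) = c * mean Z.
Proof.
move=> Z1; rewrite /mean -[c in RHS]/(fine c%:E) -fineM ?expectation_fin_num //.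
rewrite -expectationZl //; congr (fine 'E_P[_]).
by apply/funext => w /=; rewrite mulrC.
Qed.

Lemma Lfun1Z c Z : Z \in Lfun P 1 -> (fun w => c * Z w) \in Lfun P 1.
Proof. exact: rpredZ. Qed.

Lemma Lfun1_sum (I : eqType) (s : seq I) (F : I -> T -> R) :
  (forall i, F i \in Lfun P 1) -> (fun w => \sum_(i <- s) F i w) \in Lfun P 1.
Proof.
move=> F1; rewrite -[X in X \in _]fct_sumE.
by apply: rpred_sum.
Qed.

Lemma mean_sum (I : eqType) (s : seq I) (F : I -> T -> R) :
  (forall i, F i \in Lfun P 1) ->
  mean (fun w => \sum_(i <- s) F i w) = \sum_(i <- s) mean (F i).
Proof.
move=> F1; elim: s => [|i s IH].
  under eq_fun do rewrite big_nil.
  by rewrite big_nil /mean (expectation_cst P 0).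
under eq_fun do rewrite big_cons.
by rewrite big_cons -IH meanD // Lfun1_sum.
Qed.

End Mean.

(** Otherwise the difference would be a nonzero polynomial of size at most [N]
    with the [N] roots [0, ..., N - 1]. *)
Lemma poly_fun_coef (R : numDomainType) N (c e : nat -> R) :
  (forall t : R, \sum_(l < N) t ^+ l * c l = \sum_(l < N) t ^+ l * e l) ->
  forall l, (l < N)%N -> c l = e l.
Proof.
move=> ce l lN; pose p := \poly_(l < N) (c l - e l).
have p0 : p = 0.
  apply/eqP; apply: contraT => pN0.
  have := @max_poly_roots _ p [seq i%:R | i <- iota 0 N] pN0.
  rewrite size_map size_iota ltnNge size_poly; apply.
    apply/allP => t _; rewrite /root horner_poly; apply/eqP.
    under eq_bigr do rewrite mulrC mulrBr.
    by rewrite sumrB ce subrr.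
  by rewrite map_inj_uniq ?iota_uniq // => i j /eqP; rewrite eqr_nat => /eqP.
have := coef0 R l; rewrite -p0 coef_poly lN => /eqP.
by rewrite subr_eq0 => /eqP.
Qed.

Section Polarization.
Context (R : realType) (r n : nat).
Context d (T : measurableType d) (P : probability T R).
Context d' (T' : measurableType d') (P' : probability T' R).
Variables (X : T -> 'M[R]_(r, n)) (X' : T' -> 'M[R]_(r, n)).

(** Column [j] of [A] holds the coefficients of a linear form in column [j] of
    [M], so that a single matrix [A] chooses one form for every column. *)
Definition colform (A : 'M[R]_(r, n)) (j : 'I_n) (M : 'M[R]_(r, n)) : R :=
  \sum_i A i j * M i j.

Definition entries (L : seq ('I_r * 'I_n)) (M : 'M[R]_(r, n)) : R :=
  \prod_(q <- L) M q.1 q.2.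

Definition colform_mono A (k : 'I_n -> nat) M : R :=
  \prod_j colform A j M ^+ k j.

Lemma polyfun_colform A j : polyfun (colform A j).
Proof.
apply: polyfun_sum => i; apply: polyfunM; first exact: polyfun_cst.
exact: polyfun_entry.
Qed.

Lemma polyfun_entries L : polyfun (entries L).
Proof. by apply: polyfun_prod => q; exact: polyfun_entry. Qed.

Hypothesis mX : forall i j, has_moments P (fun w => X w i j).
Hypothesis mX' : forall i j, has_moments P' (fun w => X' w i j).

Definition same_mean f := mean P (f \o X) = mean P' (f \o X').

Let Lf f : polyfun f -> f \o X \in Lfun P 1.
Proof. by move=> pf; exact/has_moments_Lfun1/polyfun_has_moments. Qed.

Let Lf' f : polyfun f -> f \o X' \in Lfun P' 1.
Proof. by move=> pf; exact/has_moments_Lfun1/polyfun_has_moments. Qed.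

Lemma same_meanD f g : polyfun f -> polyfun g ->
  same_mean f -> same_mean g -> same_mean (fun M => f M + g M).
Proof.
move=> pf pg sf sg; rewrite /same_mean.
rewrite -[LHS]/(mean P (fun w => f (X w) + g (X w))) meanD; try exact: Lf.
rewrite -[RHS]/(mean P' (fun w => f (X' w) + g (X' w))) meanD; try exact: Lf'.
by congr (_ + _).
Qed.

Lemma same_meanZ c f : polyfun f -> same_mean f -> same_mean (fun M => c * f M).
Proof.
move=> pf sf; rewrite /same_mean.
rewrite -[LHS]/(mean P (fun w => c * f (X w))) meanZ; last exact: Lf.
rewrite -[RHS]/(mean P' (fun w => c * f (X' w))) meanZ; last exact: Lf'.
by congr (_ * _).
Qed.

(** Both sides are polynomials in [t], by linearity of the expectation. *)
Lemma same_mean_coef N (F : nat -> 'M[R]_(r, n) -> R) :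
  (forall l, polyfun (F l)) ->
  (forall t : R, same_mean (fun M => \sum_(l < N) t ^+ l * F l M)) ->
  forall l, (l < N)%N -> same_mean (F l).
Proof.
move=> pF sF; apply: poly_fun_coef => t.
have : mean P (fun w => \sum_(l < N) t ^+ l * F l (X w)) =
  mean P' (fun w => \sum_(l < N) t ^+ l * F l (X' w)) := sF t.
rewrite !mean_sum => [e||].
- transitivity (\sum_(l < N) mean P (fun w => t ^+ l * F l (X w))).
    by apply: eq_bigr => l _; rewrite meanZ //; exact: Lf.
  by rewrite e; apply: eq_bigr => l _; rewrite meanZ //; exact: Lf'.
- by move=> l; apply: Lfun1Z; exact: Lf'.
- by move=> l; apply: Lfun1Z; exact: Lf.
Qed.

Hypothesis same_mono : forall A k, same_mean (colform_mono A k).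

Lemma colform_shift A t i0 j0 j M :
  colform (A + t *: delta_mx i0 j0) j M =
  colform A j M + t * ((j == j0)%:R * M i0 j0).
Proof.
rewrite /colform; under eq_bigr do rewrite !mxE mulrDl.
rewrite big_split /=; congr (_ + _).
rewrite (bigD1 i0) //= big1 ?addr0 => [|i iNi0].
  rewrite eqxx /=.
  by case: eqP => [->|_]; rewrite ?(mulr1, mul1r, mulr0, mul0r).
by rewrite (negbTE iNi0) mulr0 mul0r.
Qed.

(** Polarization.  To split off the factor [M i0 j0], perturb the form of column
    [j0] by [t * M i0 j0], raise its exponent by one, and extract the
    coefficient of [t]. *)
Lemma same_mean_mono_entries L A k :
  same_mean (fun M => colform_mono A k M * entries L M).
Proof.
elim: L A k => [|[i0 j0] L IH] A k.
  have := same_mono A k; congr (same_mean _); apply/funext => M.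
  by rewrite /entries big_nil mulr1.
pose rest M := (\prod_(j | j != j0) colform A j M ^+ k j) * entries L M.
pose K := (k j0).+1.
(* [F l] is the coefficient of [t ^+ l] in the binomial expansion of the
   perturbed monomial. *)
pose F l M := 'C(K, l)%:R * (colform A j0 M ^+ (K - l) * M i0 j0 ^+ l * rest M).
have pF l : polyfun (F l).
  apply: polyfunM; first exact: polyfun_cst.
  apply: polyfunM.
    apply: polyfunM; apply: polyfunX; first exact: polyfun_colform.
    exact: polyfun_entry.
  apply: polyfunM; last exact: polyfun_entries.
  by apply: polyfun_prod => j; apply: polyfunX; exact: polyfun_colform.
have sF t : same_mean (fun M => \sum_(l < K.+1) t ^+ l * F l M).
  have := IH (A + t *: delta_mx i0 j0) (fun j => k j + (j == j0))%N.
  congr (same_mean _); apply/funext => M.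
  rewrite /colform_mono (bigD1 j0) //= colform_shift eqxx addn1 -/K mul1r.
  under eq_bigr => j jNj0.
    rewrite colform_shift (negbTE jNj0) mul0r mulr0 addr0 addn0.
    over.
  rewrite -mulrA -/(rest M) exprDn mulr_suml; apply: eq_bigr => l _.
  by rewrite /F exprMn -mulr_natl; ring.
have := @same_mean_coef K.+1 F pF sF 1%N isT.
move=> /(same_meanZ (K%:R^-1) (pF 1%N)).
congr (same_mean _); apply/funext => M.
rewrite /F bin1 mulKf ?pnatr_eq0 // /K subn1 /= expr1 /rest.
rewrite /colform_mono [in RHS](bigD1 j0) //= [in RHS]/entries big_cons /=.
rewrite -/(entries L M); ring.
Qed.

(** Multiplying [g] by a constant or an entry preserves the condition on [g],
    and sums and products of multipliers that preserve it preserve it again.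
    Quantifying over [g] is what lets the induction pass through products. *)
Lemma same_mean_multiplier f : polyfun f -> forall g, polyfun g ->
  (forall L, same_mean (fun M => g M * entries L M)) ->
  forall L, same_mean (fun M => f M * g M * entries L M).
Proof.
elim=> {f} [c|i j|f1 f2 pf1 sf1 pf2 sf2|f1 f2 pf1 sf1 pf2 sf2] g pg sg L.
- under [X in same_mean X]eq_fun do rewrite -mulrA.
  apply: same_meanZ => //; apply: polyfunM => //; exact: polyfun_entries.
- have := sg ((i, j) :: L); congr (same_mean _); apply/funext => M.
  by rewrite /entries big_cons /=; ring.
- under [X in same_mean X]eq_fun do rewrite mulrDl mulrDl.
  apply: same_meanD; [| |exact: sf1|exact: sf2].
    by apply: polyfunM; [exact: polyfunM | exact: polyfun_entries].
  by apply: polyfunM; [exact: polyfunM | exact: polyfun_entries].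
- under [X in same_mean X]eq_fun do rewrite -(mulrA (f1 _)).
  by apply: sf1; [exact: polyfunM|exact: sf2].
Qed.

Lemma polyfun_same_mean f : polyfun f -> same_mean f.
Proof.
move=> pf.
have base L : same_mean (fun M => 1 * entries L M).
  have := same_mean_mono_entries L 0 (fun=> 0%N); congr (same_mean _).
  by apply/funext => M; rewrite /colform_mono big1.
have := same_mean_multiplier pf (polyfun_cst r n 1) base [::].
congr (same_mean _); apply/funext => M.
by rewrite /entries big_nil !mulr1.
Qed.

End Polarization.

(** * Linear forms in independent Gaussian columns *)

Section RowLaw.
Local Open Scope classical_set_scope.
Variables (R : realType) (n : nat).

(** A pi-system generating the sigma-algebra of row vectors, on which the law of
    a vector with independent entries is a product. *)
Definition rectangles : set (set 'rV[R]_n) :=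
  [set A | exists2 B : 'I_n -> set R, (forall j, measurable (B j)) &
    A = [set M : 'rV[R]_n | forall j, B j (M 0 j)]].

Lemma measurable_rectangle (B : 'I_n -> set R) :
  (forall j, measurable (B j)) ->
  measurable [set M : 'rV[R]_n | forall j, B j (M 0 j)].
Proof.
move=> mB.
rewrite (_ : [set M | _] =
    \bigcap_(j in [set: 'I_n]) [set M : 'rV[R]_n | B j (M 0 j)]).
  apply: fin_bigcap_measurable => // j _.
  rewrite -[X in measurable X]setTI; exact: measurable_mx_entry.
by apply/seteqP; split => M /= BM j => [_|]; exact: BM.
Qed.

Lemma rectangles_generate : @measurable _ 'rV[R]_n = <<s rectangles >>.
Proof.
apply/seteqP; split.
  apply: smallest_sub; first exact: smallest_sigma_algebra.
  move=> _ [i [j [B mB ->]]]; apply: sub_sigma_algebra.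
  exists (fun j' => if j' == j then B else setT).
    by move=> j'; case: ifP.
  apply/seteqP; split => M /=.
    by rewrite (ord1 i) => BM j'; case: eqP => // ->.
  by move=> /(_ j); rewrite eqxx (ord1 i).
apply: smallest_sub; first exact: sigma_algebra_measurable.
by move=> _ [B mB ->]; exact: measurable_rectangle.
Qed.

Lemma rectangles_setI : setI_closed rectangles.
Proof.
move=> _ _ [B mB ->] [C mC ->]; exists (fun j => B j `&` C j).
  by move=> j; exact: measurableI.
apply/seteqP; split => M /= => [[BM CM] j|BCM]; first by split.
by split => j; have [] := BCM j.
Qed.

Lemma rectangles_law d (T : measurableType d) d' (T' : measurableType d')
    (P : probability T R) (P' : probability T' R)
    (Z : T -> 'rV[R]_n) (Z' : T' -> 'rV[R]_n) :
  measurable_fun [set: T] Z -> measurable_fun [set: T'] Z' ->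
  (forall B : 'I_n -> set R, (forall j, measurable (B j)) ->
    P [set w | forall j, B j (Z w 0 j)] =
    P' [set w | forall j, B j (Z' w 0 j)]) ->
  forall A, measurable A -> P (Z @^-1` A) = P' (Z' @^-1` A).
Proof.
move=> mZ mZ' sameB A mA.
pose iZ := isMeasurableFun.Build _ _ _ _ _ mZ.
pose iZ' := isMeasurableFun.Build _ _ _ _ _ mZ'.
pose RZ : {RV P >-> 'rV[R]_n} := HB.pack Z iZ.
pose RZ' : {RV P' >-> 'rV[R]_n} := HB.pack Z' iZ'.
have rT (k : nat) : rectangles [set: 'rV[R]_n].
  by exists (fun=> setT) => //; apply/seteqP; split => M.
have cover : \bigcup_(k : nat) [set: 'rV[R]_n] = setT.
  by rewrite bigcup_const //; exists 0%N.
have same C : rectangles C -> distribution P RZ C = distribution P' RZ' C.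
  by move=> [B mB ->]; exact: sameB.
have fin (k : nat) : (distribution P RZ [set: 'rV[R]_n] < +oo)%E.
  by rewrite (le_lt_trans (probability_le1 _ _)) ?ltry.
have := measure_unique _ _ rectangles_generate rectangles_setI rT
  cover _ _ same fin A mA.
by [].
Qed.

End RowLaw.

Section GaussianColumns.
Local Open Scope classical_set_scope.
Variables (R : realType) (r n : nat).

Lemma measurable_linear_form (a : 'cV[R]_r) :
  measurable_fun [set: 'cV[R]_r] (fun x : 'cV[R]_r => (a^T *m x) 0 0).
Proof.
apply: polyfun_measurable.
under eq_fun do rewrite mxE.
apply: polyfun_sum => i; apply: polyfunM; first exact: polyfun_cst.
exact: polyfun_entry.
Qed.

Lemma colformE (A M : 'M[R]_(r, n)) j :
  colform A j M = ((col j A)^T *m col j M) 0 0.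
Proof. by rewrite mxE; apply: eq_bigr => i _; rewrite !mxE. Qed.

Section OneMatrix.
Context d (T : measurableType d) (P : probability T R).
Variables (Sigma : 'M[R]_r) (X : {RV P >-> 'M[R]_(r, n)}).
Hypothesis gX : gaussian_columns Sigma X.

(** This is where independence of the columns enters. *)
Lemma gaussian_colforms (A : 'M[R]_(r, n)) (B : 'I_n -> set R) :
  (forall j, measurable (B j)) ->
  P [set w | forall j, B j (colform A j (X w))] =
  (\prod_j normal_law 0 (Num.sqrt (((col j A)^T *m Sigma *m col j A) 0%R 0%R))
    (B j))%E.
Proof.
move=> mB; case: gX => indX lawX.
pose C j := [set x : 'cV[R]_r | B j (((col j A)^T *m x) 0 0)].
have mC j : measurable (C j).
  by rewrite -[X in measurable X]setTI; exact: measurable_linear_form.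
have := indX [set: 'I_n]%SET C mC.
rewrite (_ : \bigcap_(i in _) _ = [set w | forall j, B j (colform A j (X w))]).
  move=> ->; apply: eq_big => [j|j _]; first by rewrite finset.in_setT.
  by have := lawX j (col j A) (B j) (mB j); rewrite mulmx0 mxE.
apply/seteqP; split => w /= BX j.
  by have := BX j; rewrite colformE; apply; rewrite /= finset.in_setT.
by move=> _; have := BX j; rewrite colformE.
Qed.

Lemma gaussian_entry_moments i j : has_moments P (fun w => X w i j).
Proof.
have [_ /(_ j (delta_mx i 0)) lawX] := gX.
apply: (normal_law_has_moments
  (s := Num.sqrt (((delta_mx i 0)^T *m Sigma *m delta_mx i 0) 0 0))).
  exact: (measurableT_comp (measurable_mx_entry i j) (measurable_funPT X)).
move=> B mB; have := lawX B mB; rewrite mulmx0 [X in normal_law X]mxE => lawB.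
apply: etrans lawB; congr (P _); apply/seteqP.
by split=> w; rewrite /= trmx_delta -rowE !mxE.
Qed.

End OneMatrix.

Context d (T : measurableType d) (P : probability T R).
Context d' (T' : measurableType d') (P' : probability T' R).
Variables (Sigma Q : 'M[R]_r).
Variables (X : {RV P >-> 'M[R]_(r, n)}) (Y : {RV P' >-> 'M[R]_(r, n)}).
Hypotheses (gX : gaussian_columns Sigma X) (gY : gaussian_columns 1%:M Y).
Hypothesis SigmaE : Sigma = Q *m Q^T.

Lemma polyfun_mulmxl i j :
  polyfun (fun M : 'M[R]_(r, n) => (Q *m M) i j).
Proof.
under eq_fun do rewrite mxE.
apply: polyfun_sum => k; apply: polyfunM; first exact: polyfun_cst.
exact: polyfun_entry.
Qed.

Lemma colform_mulmx (A M : 'M[R]_(r, n)) j :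
  colform A j (Q *m M) = colform (Q^T *m A) j M.
Proof.
by rewrite !colformE !colE !trmx_mul trmxK -!mulmxA.
Qed.

Lemma measurable_colforms d0 (T0 : measurableType d0) (P0 : probability T0 R)
    (Z : {RV P0 >-> 'M[R]_(r, n)}) A :
  measurable_fun [set: T0] (fun w => \row_j colform A j (Z w)).
Proof.
apply: measurable_fun_mx => i j; under eq_fun do rewrite mxE.
apply: (measurableT_comp (f := colform A j)) => //.
exact: polyfun_measurable (polyfun_colform A j).
Qed.

(** A form with coefficients [a] on a column of [X], and one with coefficients
    [Q^T *m a] on a column of [Y], have the same variance
    [a^T *m Sigma *m a], since [Sigma = Q *m Q^T]. *)
Lemma gaussian_colforms_same_law A C : measurable C ->
  P ((fun w => \row_j colform A j (X w)) @^-1` C) =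
  P' ((fun w => \row_j colform (Q^T *m A) j (Y w)) @^-1` C).
Proof.
apply: rectangles_law; try exact: measurable_colforms.
move=> B mB.
have rowE T0 (Z : T0 -> 'M[R]_(r, n)) A0 :
    [set w | forall j, B j ((\row_j colform A0 j (Z w)) 0 j)] =
    [set w | forall j, B j (colform A0 j (Z w))].
  by apply/seteqP; split => w /= BZ j; have := BZ j; rewrite mxE.
rewrite !rowE.
apply: etrans (gaussian_colforms gX A mB) _.
apply: etrans _ (esym (gaussian_colforms gY (Q^T *m A) mB)).
apply: eq_bigr => j _; congr (normal_law _ (Num.sqrt (fun_of_matrix _ _ _)) _).
by rewrite SigmaE mulmx1 !colE !trmx_mul trmxK !mulmxA.
Qed.

(** Moment form of the statement that [X] and [Q *m Y] have the same law. *)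
Lemma gaussian_polyfun_mean f : polyfun f ->
  mean P (fun w => f (X w)) = mean P' (fun w => f (Q *m Y w)).
Proof.
move=> pf; apply: (polyfun_same_mean (X := X) (X' := fun w => Q *m Y w)) => //.
- by move=> i j; exact: (gaussian_entry_moments gX).
- move=> i j; apply: (polyfun_has_moments (f := fun M => (Q *m M) i j)).
    by move=> ? ?; exact: (gaussian_entry_moments gY).
  exact: polyfun_mulmxl.
- move=> A k; rewrite /same_mean /mean; congr fine.
  pose g (z : 'rV[R]_n) := \prod_j z 0 j ^+ k j.
  have mg : measurable_fun [set: 'rV[R]_n] g.
    apply: polyfun_measurable; apply: polyfun_prod => j.
    by apply: polyfunX; exact: polyfun_entry.
  have := same_law_expectation (@measurable_colforms _ _ _ X A)
    (@measurable_colforms _ _ _ Y (Q^T *m A))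
    (@gaussian_colforms_same_law A) mg.
  rewrite /g; under eq_fun do under eq_bigr do rewrite mxE.
  move=> ->; congr expectation; apply/funext => w /=.
  by apply: eq_bigr => j _; rewrite mxE colform_mulmx.
Qed.

End GaussianColumns.

(** * Moments of Wishart matrices *)

Section Wishart.
Local Open Scope classical_set_scope.
Variables (R : realType) (r n : nat).

Lemma polyfun_gram i j :
  polyfun (fun M : 'M[R]_(r, n) => (M *m M^T) i j).
Proof.
under eq_fun do rewrite mxE; apply: polyfun_sum => k; apply: polyfunM.
  exact: polyfun_entry.
by under eq_fun do rewrite mxE; exact: polyfun_entry.
Qed.

Lemma polyfun_compound m i j :
  polyfun (fun M : 'M[R]_r => compound m M i j).
Proof. by under eq_fun do rewrite mxE; exact: polyfun_det. Qed.

(** A matrix with a Wishart law need not be a Gram matrix on its own probability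
    space; polynomial expectations are moved to a space where it is one. *)
Lemma wishart_polyfun (Sigma : 'M[R]_r) d (T : measurableType d)
    (P : probability T R) (S : {RV P >-> 'M[R]_r}) :
  wishart n Sigma (distribution P S) ->
  exists (d0 : measure_display) (T0 : measurableType d0)
    (P0 : probability T0 R) (X : {RV P0 >-> 'M[R]_(r, n)}),
  gaussian_columns Sigma X /\ forall f, polyfun f ->
    (fun w => f (S w)) \in Lfun P 1 /\
    mean P (fun w => f (S w)) = mean P0 (fun w => f (X w *m (X w)^T)).
Proof.
move=> [d0 [T0 [P0 [X [gX lawS]]]]]; exists d0, T0, P0, X; split=> // f pf.
have mgram : measurable_fun [set: T0] (fun w => X w *m (X w)^T).
  apply: measurable_fun_mx => i j.
  apply: (measurableT_comp (f := fun M : 'M[R]_(r, n) => (M *m M^T) i j)) => //.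
  exact: polyfun_measurable (polyfun_gram i j).
have mf := polyfun_measurable pf.
have mS : measurable_fun [set: T] S by [].
split.
  apply: (same_law_Lfun1 mS mgram lawS mf).
  apply: has_moments_Lfun1.
  apply: (polyfun_has_moments (f := fun M => f (M *m M^T))).
    by move=> i j; exact: (gaussian_entry_moments gX).
  by apply: polyfun_comp => //; exact: polyfun_gram.
by rewrite /mean (same_law_expectation mS mgram lawS mf).
Qed.

(** Moment form of the statement that [S] and [Q *m W *m Q^T] have the same
    law. *)
Lemma wishart_congruence_mean (Sigma Q : 'M[R]_r)
    dS (TS : measurableType dS) (PS : probability TS R)
    (S : {RV PS >-> 'M[R]_r})
    dW (TW : measurableType dW) (PW : probability TW R)
    (W : {RV PW >-> 'M[R]_r}) f :
  Sigma = Q *m Q^T ->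
  wishart n Sigma (distribution PS S) ->
  wishart n 1%:M (distribution PW W) ->
  polyfun f ->
  mean PS (fun w => f (S w)) = mean PW (fun w => f (Q *m W w *m Q^T)).
Proof.
move=> SigmaE /wishart_polyfun[d [T [P [X [gX lawS]]]]].
move=> /wishart_polyfun[d' [T' [P' [Y [gY lawW]]]]] pf.
have [_ ->] := lawS f pf.
have pfQ : polyfun (fun M => f (Q *m M *m Q^T)).
  apply: polyfun_comp => // i j; under eq_fun do rewrite mxE.
  apply: polyfun_sum => k; apply: polyfunM; last exact: polyfun_cst.
  exact: polyfun_mulmxl.
have [_ ->] := lawW _ pfQ.
rewrite (gaussian_polyfun_mean gX gY SigmaE (f := fun M => f (M *m M^T))).
  congr mean; apply/funext => w.
  by rewrite trmx_mul !mulmxA.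
by apply: polyfun_comp => //; exact: polyfun_gram.
Qed.

End Wishart.

Section MatrixExpectation.
Context d (T : measurableType d) (R : realType) (P : probability T R).

Lemma mxExp_mulmx p q p' q' (A : 'M[R]_(p', p)) (B : 'M[R]_(q, q'))
    (M : T -> 'M[R]_(p, q)) :
  (forall i j, (fun w => M w i j) \in Lfun P 1) ->
  mxExp P (fun w => A *m M w *m B) = A *m mxExp P M *m B.
Proof.
move=> M1; apply/matrixP => i j; rewrite !mxE -[LHS]/(mean P _).
have -> : (fun w => (A *m M w *m B) i j) =
    (fun w => \sum_l \sum_k A i k * B l j * M w k l).
  apply/funext => w; rewrite mxE; apply: eq_bigr => l _.
  by rewrite mxE mulr_suml; apply: eq_bigr => k _; rewrite mulrAC.
have L1 l k : (fun w => A i k * B l j * M w k l) \in Lfun P 1 by exact: Lfun1Z.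
rewrite mean_sum => [|l]; last exact: Lfun1_sum.
apply: eq_bigr => l _; rewrite mean_sum // mxE mulr_suml; apply: eq_bigr => k _.
by rewrite meanZ // mxE mulrAC.
Qed.

Lemma mxCovE p q (M : T -> 'M[R]_(p, q)) :
  (forall i j, (fun w => M w i j) \in Lfun P 1) ->
  (forall i j k l, (fun w => M w i j * M w k l) \in Lfun P 1) ->
  mxCov P M = mxExp P (fun w => M w *t M w) - mxExp P M *t mxExp P M.
Proof.
move=> M1 M2; apply/matrixP => i j; rewrite !mxE.
rewrite covarianceE //; last exact: M2.
rewrite fineB ?fineM ?fin_numM ?expectation_fin_num //; last exact: M2.
congr (fine 'E_P[_] - _); apply/funext => w; by rewrite mxE.
Qed.

End MatrixExpectation.

Theorem proposition3p3 (R : realType) (r n m : nat)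
    (Sigma Q : 'M[R]_r)
    (dS : measure_display) (TS : measurableType dS) (PS : probability TS R)
    (S : {RV PS >-> 'M[R]_r})
    (dW : measure_display) (TW : measurableType dW) (PW : probability TW R)
    (W : {RV PW >-> 'M[R]_r}) :
  (0 < r)%N -> (0 < n)%N -> (0 < m <= r)%N ->
  posdef Sigma -> is_posdef_sqrt Sigma Q ->
  wishart n Sigma (distribution PS S) ->
  wishart n 1%:M (distribution PW W) ->
  [/\ mxExp PS (fun w => compound m (S w)) =
        compound m Q *m mxExp PW (fun w => compound m (W w)) *m compound m Q,
      mxExp PS (fun w => compound m (S w) *t compound m (S w)) =
        (compound m Q *t compound m Q)
        *m mxExp PW (fun w => compound m (W w) *t compound m (W w))
        *m (compound m Q *t compound m Q),
      mxCov PS (fun w => compound m (S w)) =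
        mxExp PS (fun w => compound m (S w) *t compound m (S w))
        - mxExp PS (fun w => compound m (S w))
          *t mxExp PS (fun w => compound m (S w))
    & mxCov PS (fun w => compound m (S w)) =
        (compound m Q *t compound m Q)
        *m mxCov PW (fun w => compound m (W w))
        *m (compound m Q *t compound m Q)].
Proof.
move=> _ _ _ _ [[QT _] QQ] lawS lawW.
have SigmaE : Sigma = Q *m Q^T by rewrite QT QQ.
have congr_mean f := wishart_congruence_mean (f := f) SigmaE lawS lawW.
have [dX [TX [PX [X [_ polyS]]]]] := wishart_polyfun lawS.
have [dY [TY [PY [Y [_ polyW]]]]] := wishart_polyfun lawW.
have S1 i j : (fun w => compound m (S w) i j) \in Lfun PS 1.
  by have [] := polyS _ (@polyfun_compound R r m i j).
have W1 i j : (fun w => compound m (W w) i j) \in Lfun PW 1.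
  by have [] := polyW _ (@polyfun_compound R r m i j).
have poly2 i j k l :
    polyfun (fun M : 'M[R]_r => compound m M i j * compound m M k l).
  by apply: polyfunM; exact: polyfun_compound.
have S2 i j k l :
    (fun w => compound m (S w) i j * compound m (S w) k l) \in Lfun PS 1.
  by have [] := polyS _ (poly2 i j k l).
have W2 i j k l :
    (fun w => compound m (W w) i j * compound m (W w) k l) \in Lfun PW 1.
  by have [] := polyW _ (poly2 i j k l).
have compoundQ (M : 'M[R]_r) : compound m (Q *m M *m Q^T) =
    compound m Q *m compound m M *m compound m Q.
  by rewrite QT !compound_mul.
have E1 : mxExp PS (fun w => compound m (S w)) =
    compound m Q *m mxExp PW (fun w => compound m (W w)) *m compound m Q.
  rewrite -mxExp_mulmx //; apply/matrixP => i j; rewrite !mxE.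
  apply: etrans (congr_mean _ (@polyfun_compound R r m i j)) _.
  by under eq_fun do rewrite compoundQ.
have E2 : mxExp PS (fun w => compound m (S w) *t compound m (S w)) =
    (compound m Q *t compound m Q)
    *m mxExp PW (fun w => compound m (W w) *t compound m (W w))
    *m (compound m Q *t compound m Q).
  rewrite -mxExp_mulmx => [|i j]; last by under eq_fun do rewrite mxE.
  apply/matrixP => i j; rewrite !mxE; under eq_fun do rewrite mxE.
  apply: etrans (congr_mean _ (poly2 _ _ _ _)) _.
  congr mean; apply/funext => w.
  by rewrite !compoundQ !tensmx_mul [RHS]mxE.
split => //; first exact: mxCovE.
rewrite !mxCovE // E2 E1 mulmxBr mulmxBl; congr (_ - _).
by rewrite !tensmx_mul.
Qed.
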